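(* Let $1\le m\le n$ be integers. The map $\pi\mapsto(\vec r(\pi),\sigma(\pi))$ is a bijection from $\mathrm{PF}(m,n)$ onto $\mathscr C(m,n)$.
   Context: $\mathrm{PF}(m,n)$ is the set of parking functions with $m$ cars and $n$ spots: sequences $\pi=(\pi_1,\dots,\pi_m)\in\{1,\dots,n\}^m$ such that, when spots $1,\dots,n$ are initially empty and for $i=1,\dots,m$ in turn car $i$ parks in the first empty spot among $\pi_i,\pi_i+1,\dots,n$, every car succeeds in parking. For $\pi\in\{1,\dots,n\}^m$, its specification is $\vec r(\pi)=(r_1,\dots,r_n)$ with $r_k=\#\{i:\pi_i=k\}$, and its order permutation $\sigma(\pi)\in\mathfrak S_m$ is given by $\sigma_i=\#\{j:\pi_j<\pi_i,\text{ or }\pi_j=\pi_i\text{ and }j\le i\}$. A pair $(\vec r,\sigma)$ with $\vec r=(r_1,\dots,r_n)$ a vector of nonnegative integers and $\sigma\in\mathfrak S_m$ is called compatible if for every $k\in\{1,\dots,n\}$ the values $1+\sum_{i=1}^{k-1}r_i,\dots,\sum_{i=1}^k r_i$ appear from left to right in the word $\sigma=\sigma_1\sigma_2\cdots\sigma_m$; $\vec r$ is called balanced if there exist integers $0=:k_0<k_1<\dots<k_{n-m}<k_{n-m+1}:=n+1$ such that $\sum_{s=1}^{k_i}r_s=k_i-i$ for all $1\le i\le n-m$, $\sum_{s=1}^j r_s>j-i-1$ for all $k_i<j<k_{i+1}$ and $0\le i\le n-m$, and $\sum_{s=1}^n r_s=m$. $\mathscr C(m,n)$ is the set of compatible pairs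 $(\vec r,\sigma)$ with $\vec r$ balanced. *)

(* Defs.v *)
From mathcomp Require Import all_boot all_fingroup.
From mathcomp Require Import classical_sets functions.

Set Implicit Arguments.
Unset Strict Implicit.
Unset Printing Implicit Defensive.

(* Cars, spots and the entries of vectors are numbered from 0: [i : 'I_m] is
   car i + 1 and [k : 'I_n] is spot k + 1. *)

(* [enum 'I_n] is increasing, so the head is the first empty spot. *)
Definition first_empty (n : nat) (occ : seq 'I_n) (p : 'I_n) : option 'I_n :=
  ohead [seq q : 'I_n <- enum 'I_n | (p <= q) && (q \notin occ)].

Fixpoint all_park (n : nat) (occ s : seq 'I_n) : bool :=
  if s is p :: s' then
    if first_empty occ p is Some q then all_park (q :: occ) s' else false
  else true.

Definition PF (m n : nat) : set (m.-tuple 'I_n) :=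
  [set pi : m.-tuple 'I_n | all_park [::] pi]%classic.
Arguments PF : clear implicits.

Definition specification (m n : nat) (pi : m.-tuple 'I_n) : {ffun 'I_n -> nat} :=
  [ffun k => #|[pred i : 'I_m | tnth pi i == k]|].

Definition order_pred (m n : nat) (pi : m.-tuple 'I_n) (i : 'I_m) : pred 'I_m :=
  [pred j : 'I_m | (tnth pi j < tnth pi i)
                   || (tnth pi j == tnth pi i) && (j <= i)].

Lemma order_card_gt0 (m n : nat) (pi : m.-tuple 'I_n) (i : 'I_m) :
  0 < #|order_pred pi i|.
Proof. by apply/card_gt0P; exists i; rewrite inE eqxx leqnn orbT. Qed.

Lemma order_card_ltn (m n : nat) (pi : m.-tuple 'I_n) (i : 'I_m) :
  #|order_pred pi i|.-1 < m.
Proof.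
rewrite prednK ?order_card_gt0 //.
by apply: leq_trans (max_card _) _; rewrite card_ord.
Qed.

(* sigma_i - 1, as an element of 'I_m. *)
Definition order_fun (m n : nat) (pi : m.-tuple 'I_n) (i : 'I_m) : 'I_m :=
  Ordinal (order_card_ltn pi i).

Lemma order_fun_inj (m n : nat) (pi : m.-tuple 'I_n) : injective (order_fun pi).
Proof.
have main (i j : 'I_m) : order_pred pi j i -> i != j ->
    #|order_pred pi i| < #|order_pred pi j|.
  move=> ij nij; apply: proper_card; apply/fintype.properP; split.
    apply/fintype.subsetP=> k; move: ij; rewrite !inE -!val_eqE /= => ij ki.
    case/orP: ij => [ij|/andP[/eqP eij lij]].
      by case/orP: ki => [ki|/andP[/eqP-> _]]; rewrite ?ij ?(ltn_trans ki ij).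
    rewrite -eij; case/orP: ki => [->//|/andP[-> ki]].
    by rewrite (leq_trans ki lij) orbT.
  exists j; first by rewrite inE eqxx leqnn orbT.
  move: ij nij; rewrite !inE -!val_eqE /= => /orP[ij _|/andP[/eqP eij lij] nij].
    by rewrite ltnNge (ltnW ij) gtn_eqF.
  by rewrite eij ltnn eqxx /= -ltnNge ltn_neqAle nij.
move=> i j /(congr1 (fun x : 'I_m => (nat_of_ord x).+1)) /=.
rewrite !prednK ?order_card_gt0 // => eq_card_ij; apply/eqP.
apply: contraT => nij; have [ij|ji] : order_pred pi j i \/ order_pred pi i j.
- rewrite /order_pred /= -!val_eqE /= (eq_sym (val (tnth pi j))).
  by case: ltngtP => _; [left|right|apply/orP; exact: leq_total].
- by have := main _ _ ij nij; rewrite eq_card_ij ltnn.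
- by rewrite eq_sym in nij; have := main _ _ ji nij; rewrite eq_card_ij ltnn.
Qed.

Definition order_permutation (m n : nat) (pi : m.-tuple 'I_n) : {perm 'I_m} :=
  perm (@order_fun_inj m n pi).

(* r_1 + ... + r_j. *)
Definition partial_sum (n : nat) (r : {ffun 'I_n -> nat}) (j : nat) : nat :=
  \sum_(s < n | s < j) r s.

(* sigma_1 ... sigma_m, with letters in {1, ..., m}. *)
Definition word (m : nat) (sigma : {perm 'I_m}) : seq nat :=
  [seq (sigma i).+1 | i <- enum 'I_m].

Definition compatible (m n : nat) (r : {ffun 'I_n -> nat}) (sigma : {perm 'I_m}) :
    Prop :=
  forall k : 'I_n, subseq (iota (1 + partial_sum r k) (r k)) (word sigma).

(* Only the values [k 0, ..., k (n - m).+1] are constrained.  The subtractions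
   involving [i] do not truncate: strict monotonicity gives [i <= k i]. *)
Definition balanced (m n : nat) (r : {ffun 'I_n -> nat}) : Prop :=
  exists k : nat -> nat,
    [/\ k 0 = 0 /\ k (n - m + 1) = n + 1,
        forall i, i <= n - m -> k i < k i.+1,
        forall i, 1 <= i <= n - m -> partial_sum r (k i) = k i - i,
        forall i j, i <= n - m -> k i < j < k i.+1 ->
          partial_sum r j > j - i - 1
      & \sum_(s < n) r s = m].

Definition C (m n : nat) : set ({ffun 'I_n -> nat} * {perm 'I_m}) :=
  [set x : {ffun 'I_n -> nat} * {perm 'I_m}
     | compatible x.1 x.2 /\ balanced m x.1]%classic.
Arguments C : clear implicits.

(* Main.v *)
(* By the Hall-type criterion, pi parks iff for every j at most n - j cars prefer
   a spot beyond j, i.e. iff j - (r_1 + ... + r_j) <= n - m for all j.  This is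
   balancedness of r: k_i is the first j at which j - (r_1 + ... + r_j) reaches i,
   and it is the i-th spot left empty.
   The order permutation maps the cars preferring spot k onto the k-th block of
   consecutive values, of length r_k, so pi is recovered from (r, sigma) by reading
   off the block containing sigma_i; compatibility says exactly that ties are
   ranked by arrival. *)
Require Import Defs.
From mathcomp Require Import all_boot all_fingroup.
From mathcomp Require Import classical_sets functions zify.

Set Implicit Arguments.
Unset Strict Implicit.
Unset Printing Implicit Defensive.

(** * The Hall-type criterion for parking *)

Lemma count_geq_uniq n (occ : seq 'I_n) j :
  uniq occ -> count (fun x : 'I_n => j <= x) occ <= n - j.
Proof.
move=> uocc; rewrite -size_filter -(size_map val) -(size_iota j (n - j)).
apply: uniq_leq_size; first by rewrite map_inj_uniq ?filter_uniq //; exact: val_inj.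
by move=> _ /mapP[x + ->]; rewrite mem_filter mem_iota => /andP[]; have /= := ltn_ord x; lia.
Qed.

(** Each spot of the full run from [j] to [k - 1] occurs at least once in [occ]; they are peeled off
    one at a time. *)
Lemma count_geq_full n (occ : seq 'I_n) j k : j <= k <= n ->
    (forall q : 'I_n, j <= q < k -> q \in occ) ->
  k - j + count (fun x : 'I_n => k <= x) occ <= count (fun x : 'I_n => j <= x) occ.
Proof.
case/andP=> jk; rewrite -(subnKC jk) addKn; elim: (k - j) => [|d IHd] jd full.
  by rewrite addn0.
have jdn : j + d < n by lia.
apply: leq_trans (IHd _ _); [|lia|by move=> q qjd; apply: full; lia].
rewrite addSnnS leq_add2l.
have -> : count (fun x : 'I_n => j + d <= x) occ =
    count (pred1 (Ordinal jdn)) occ + count (fun x : 'I_n => j + d.+1 <= x) occ.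
  elim: occ {IHd full} => //= x occ ->.
  by rewrite addnACA; congr (_ + _); rewrite -val_eqE /=; lia.
by rewrite -add1n leq_add2r -has_count has_pred1 full //=; lia.
Qed.

Lemma first_emptyP n (occ : seq 'I_n) (p : 'I_n) :
  match first_empty occ p with
  | Some q => [/\ p <= q, q \notin occ & forall x : 'I_n, p <= x < q -> x \in occ]
  | None => forall x : 'I_n, p <= x -> x \in occ
  end.
Proof.
rewrite /first_empty; set s := [seq _ <- _ | _].
have mems x : (x \in s) = (p <= x) && (x \notin occ).
  by rewrite mem_filter mem_enum andbT.
have : sorted (fun x y : 'I_n => x < y) s.
  apply: sorted_filter; first by move=> x y z /=; exact: ltn_trans.
  by have := iota_ltn_sorted 0 n; rewrite -val_enum_ord sorted_map.
case: s mems => [|q s] mems /=.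
  by move=> _ x px; have := mems x; rewrite px in_nil /= => /esym/negbFE.
rewrite path_sortedE => [/andP[/allP mins _]|x y z]; last exact: ltn_trans.
have /andP[pq qocc] : (p <= q) && (q \notin occ) by rewrite -mems mem_head.
split=> // x /andP[px xq]; have := mems x; rewrite px inE /=.
case: eqP => [xqE|_] /=; first by rewrite xqE ltnn in xq.
case: (boolP (x \in s)) => [/mins|_ /esym/negbFE//].
by rewrite ltnNge ltnW.
Qed.

(** Counting occupied spots together with the preferences of waiting cars makes the criterion
    inductive: when a car parks, its preference [p] leaves one count and its spot [q] enters the
    other. *)
Lemma all_parkP n (occ s : seq 'I_n) : uniq occ ->
  reflect (forall j, j <= n -> count (fun x : 'I_n => j <= x) occ
                             + count (fun x : 'I_n => j <= x) s <= n - j)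
          (all_park occ s).
Proof.
elim: s occ => [|p s IHs] occ uocc.
  by apply: ReflectT => j _; rewrite addn0 count_geq_uniq.
rewrite /=; have := first_emptyP occ p; case: first_empty => [q|] => [[pq qocc full]|full].
  have uq : uniq (q :: occ) by rewrite /= qocc.
  apply: (iffP (IHs _ uq)) => /= H j jn; have := H j jn.
    (* As [p <= q], replacing [q] by [p] can only lower the counts. *)
    by case: (leqP j p); case: (leqP j q) => /=; lia.
  case: (leqP j p) => jp; first by rewrite (leq_trans jp pq); lia.
  case: (leqP j q) => jq /=; last by lia.
  (* Spots p, ..., j - 1 are occupied, so the bound at p implies the one at j. *)
  have := H p (ltnW (ltn_ord p)); rewrite leqnn.
  have : j - p + count (fun x : 'I_n => j <= x) occ <= count (fun x : 'I_n => p <= x) occ.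
    by apply: count_geq_full => [|x pxj]; [rewrite ltnW | apply: full; lia].
  have : count (fun x : 'I_n => j <= x) s <= count (fun x : 'I_n => p <= x) s.
    by apply: sub_count => x; apply: leq_trans; exact: ltnW.
  by lia.
(* All spots from [p] on are taken, so at [j = p] these spots and the present car already exceed
   [n - p]. *)
apply: ReflectF => /(_ p (ltnW (ltn_ord p))) /=; rewrite leqnn.
have : n - p + count (fun x : 'I_n => n <= x) occ <= count (fun x : 'I_n => p <= x) occ.
  apply: count_geq_full => [|x /andP[px _]]; last exact: full.
  by rewrite leqnn ltnW.
by have := ltn_ord p; lia.
Qed.

(** * Blocks of values cut out by partial sums, and balanced vectors *)

Section PartialSum.
Variables (n : nat) (r : {ffun 'I_n -> nat}).

Lemma partial_sum0 : partial_sum r 0 = 0.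
Proof. exact: big_pred0. Qed.

Lemma partial_sum_total : partial_sum r n = \sum_(s < n) r s.
Proof. by apply: eq_bigl => s; rewrite ltn_ord. Qed.

Lemma partial_sumS (k : 'I_n) : partial_sum r k.+1 = partial_sum r k + r k.
Proof.
rewrite /partial_sum (bigD1 k) //= addnC; congr (_ + _).
by apply: eq_bigl => s; rewrite -val_eqE /=; lia.
Qed.

Lemma leq_partial_sum : {homo partial_sum r : i j / i <= j}.
Proof.
move=> i j ij; rewrite /partial_sum big_mkcond [leqRHS]big_mkcond.
by apply: leq_sum => s _; case: ifP => // si; rewrite (leq_trans si ij).
Qed.

Lemma partial_sum_block_inj (k l : 'I_n) v :
  partial_sum r k <= v < partial_sum r k.+1 ->
  partial_sum r l <= v < partial_sum r l.+1 -> k = l.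
Proof.
move=> /andP[kv vk] /andP[lv vl]; apply: val_inj => /=.
case: (ltngtP k l) => // /leq_partial_sum le.
  by have := leq_trans vk (leq_trans le lv); rewrite ltnn.
by have := leq_trans vl (leq_trans le kv); rewrite ltnn.
Qed.

Lemma partial_sum_block_exists v :
  v < partial_sum r n -> exists k : 'I_n, partial_sum r k <= v < partial_sum r k.+1.
Proof.
move=> vn; have ex : exists j, v < partial_sum r j by exists n.
have [[|j] vj minj] := find_ex_minn ex; first by rewrite partial_sum0 in vj.
have jn : j < n := minj n vn.
exists (Ordinal jn); rewrite vj andbT leqNgt.
by apply: contraT => /negbNE/minj; rewrite ltnn.
Qed.

(* [k i] is the first [j] with [j - partial_sum r j = i]; it exists because
   [j - partial_sum r j] increases by at most 1 at each step. *)
Lemma balancedP m : m <= n ->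
  balanced m r <-> \sum_(s < n) r s = m /\
                   forall j, j <= n -> j <= partial_sum r j + (n - m).
Proof.
move=> mn; split=> [[k [[k0 kn] _ keq kgt tot]]|[tot park]].
  split=> // j jn.
  (* Since [k 0 = 0], the intervals between consecutive values of [k] cover everything below [k i];
     for [i = n - m + 1] this reaches every [j <= n]. *)
  have find_gap i : i <= n - m + 1 -> j < k i ->
      exists2 i', i' < i & k i' <= j < k i'.+1.
    elim: i => [|i IHi] i_le; first by rewrite k0.
    case: (leqP (k i) j) => [kij jki|jki _]; first by exists i; rewrite // kij.
    by have [i' ii' ?] := IHi (ltnW i_le) jki; exists i' => //; exact: ltnW.
  have [||i i_lt /andP[kij jki]] := find_gap (n - m + 1); rewrite ?kn //; first lia.
  case: (ltngtP (k i) j) kij => // [ltkj|eqkj] _.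
    by have := kgt i j; rewrite ltkj jki => /(_ _ isT); lia.
  case: i i_lt eqkj {jki} => [|i] i_lt eqkj; first by rewrite -eqkj k0.
  by have := keq i.+1; rewrite eqkj => ->; lia.
pose P i j := partial_sum r j + i <= j.
(* When no index satisfies [P i], [find] returns the length [n.+1], which is exactly the value
   required of [k (n - m + 1)]. *)
pose k i := find (P i) (iota 0 n.+1).
have k_le i : k i <= n.+1 by rewrite -[n.+1](size_iota 0) find_size.
have kmin i j : j < k i -> j < partial_sum r j + i.
  move=> jk; have jn : j < n.+1 := leq_trans jk (k_le i).
  by have := before_find 0 jk; rewrite nth_iota // add0n /P leqNgt => /negbFE.
have kP i : i <= n - m -> k i <= n /\ partial_sum r (k i) + i = k i.
  move=> inm; have kin : k i < n.+1.
    rewrite -[n.+1](size_iota 0) -has_find; apply/hasP; exists n.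
      by rewrite mem_iota add0n /=.
    by rewrite /P partial_sum_total tot; lia.
  split=> //; apply/eqP; rewrite eqn_leq; apply/andP; split.
    have : has (P i) (iota 0 n.+1) by rewrite has_find size_iota.
    by move=> /(nth_find 0); rewrite nth_iota // add0n.
  (* The index just before [k i] fails [P i], and partial sums do not decrease, so [P i] holds at
     [k i] with equality. *)
  case E : (k i) => [|j] //; have := kmin i j; rewrite E ltnSn => /(_ isT).
  by have := leq_partial_sum (leqnSn j); lia.
exists k; split=> // [|i inm|i /andP[_ inm]|i j inm /andP[kij jki]].
- split; first by rewrite /k /= /P partial_sum0.
  rewrite addn1 [RHS]addn1; apply/eqP; rewrite eqn_leq k_le /= ltnNge.
  (* An index satisfying [P (n - m).+1] would violate the bound [park]. *)
  apply/negP => kn; have := park _ kn.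
  have : has (P (n - m).+1) (iota 0 n.+1) by rewrite has_find size_iota.
  by move=> /(nth_find 0); rewrite -/(k _) nth_iota // add0n /P; lia.
- have [kn kE] := kP _ inm; case: (ltnP (k i.+1) n.+1) => [kSn|]; last by lia.
  have : has (P i.+1) (iota 0 n.+1) by rewrite has_find size_iota.
  move=> /(nth_find 0); rewrite -/(k _) nth_iota // add0n /P => PS.
  case: (ltngtP (k i) (k i.+1)) => // [/kmin|eqk]; first by lia.
  by move: PS; rewrite -eqk; lia.
- by have [_] := kP _ inm; lia.
- by have [_ kE] := kP _ inm; have := kmin _ _ jki; lia.
Qed.

End PartialSum.

(** * Compatibility in terms of positions *)

Lemma card_perm_interval m (sigma : {perm 'I_m}) a b : b <= m ->
  #|[pred i | a <= sigma i < b]| = b - a.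
Proof.
move=> bm; rewrite -sum1_card (reindex_perm sigma^-1%g) /=.
under eq_bigl => i do rewrite inE permKV.
rewrite -(big_mkord (fun i => a <= i < b) (fun=> 1)) sum1_count -size_filter.
rewrite -(size_iota a (b - a)); apply/perm_size/uniq_perm; rewrite ?iota_uniq //.
  by rewrite filter_uniq ?iota_uniq.
by move=> i; rewrite mem_filter /index_iota !mem_iota; lia.
Qed.

(** The letters of the word are distinct and [(sigma i).+1] stands at position [i], so being a
    subword amounts to having increasing positions. *)
Lemma compatibleP m n (r : {ffun 'I_n -> nat}) (sigma : {perm 'I_m}) :
    \sum_(s < n) r s = m ->
  compatible r sigma <->
  forall (k : 'I_n) (i j : 'I_m), partial_sum r k <= sigma i ->
    sigma i < sigma j -> sigma j < partial_sum r k.+1 -> i < j.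
Proof.
move=> tot; set w := word sigma.
pose before x y := index x w < index y w.
have before_tr : transitive before by move=> y x z; exact: ltn_trans.
have letter_inj : injective (fun i => (sigma i).+1).
  by move=> i j [] /val_inj/perm_inj.
have indexE i : index (sigma i).+1 w = i by rewrite index_map // index_enum_ord.
have w_uniq : uniq w by rewrite map_inj_uniq ?enum_uniq.
have w_sorted : sorted before w.
  rewrite sorted_map; have := iota_ltn_sorted 0 m; rewrite -val_enum_ord sorted_map.
  by apply: sub_sorted => i j /=; rewrite /before !indexE.
split=> [comp k i j|H k].
  rewrite partial_sumS => ki ij jk; have := comp k; rewrite -/w => sub.
  have := subseq_sorted before_tr sub w_sorted; set a := 1 + _.
  move=> /(sorted_ltn_nth before_tr 0).
  move=> /(_ (sigma i - partial_sum r k) (sigma j - partial_sum r k)).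
  rewrite !inE !size_iota !nth_iota; [|lia..].
  have -> : a + (sigma i - partial_sum r k) = (sigma i).+1 by lia.
  have -> : a + (sigma j - partial_sum r k) = (sigma j).+1 by lia.
  by rewrite /before !indexE; apply; lia.
(* This bound ensures that every value of the block is a letter of the word. *)
have Skm : partial_sum r k.+1 <= m.
  by rewrite -tot -partial_sum_total; apply: leq_partial_sum; exact: ltn_ord.
have letterP x : 0 < x <= m -> exists i, x = (sigma i).+1.
  case: x => // x xm; exists (sigma^-1%g (Ordinal (xm : x < m))).
  by rewrite permKV.
rewrite partial_sumS in Skm; set s := iota _ _.
(* Both lists have the same members and are sorted by position, a strict order, hence they
   coincide. *)
suff -> : s = [seq x <- w | x \in s] by exact: filter_subseq.
apply: (irr_sorted_eq before_tr).
- by move=> x; rewrite /before ltnn.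
- apply: (@sub_in_sorted _ (mem s) ltn) (iota_ltn_sorted _ _); last exact/allP.
  move=> x y; rewrite !mem_iota => xs ys xy.
  have [|i xE] := letterP x; first lia.
  have [|j yE] := letterP y; first lia.
  by rewrite xE yE /before !indexE; apply: (H k); rewrite ?partial_sumS; lia.
- by apply: sorted_filter.
- move=> x; rewrite mem_filter; case: (boolP (x \in s)) => //=.
  rewrite mem_iota => xs; have [|i ->] := letterP x; first lia.
  by apply/esym/mapP; exists i; rewrite ?mem_enum.
Qed.

(** * Specification and order permutation of a given tuple *)

Section Tuple.
Variables (m n : nat) (pi : m.-tuple 'I_n).

Lemma partial_sum_specification j :
  partial_sum (specification pi) j = #|[pred i | tnth pi i < j]|.
Proof.
rewrite -sum1_card (partition_big (tnth pi) (fun s => s < j)) //=.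
apply: eq_bigr => s sj; rewrite ffunE -sum1_card.
by apply: eq_bigl => i; rewrite !inE andbC; case: eqP => // ->.
Qed.

Lemma sum_specification : \sum_(s < n) specification pi s = m.
Proof.
rewrite -partial_sum_total partial_sum_specification -[RHS]card_ord.
by apply: eq_card => i; rewrite !inE ltn_ord.
Qed.

Lemma count_geq_specification j :
  count (fun x : 'I_n => j <= x) pi + partial_sum (specification pi) j = m.
Proof.
rewrite -sum1_count big_tuple partial_sum_specification sum1_card.
rewrite -[RHS]card_ord -(cardC [pred i | tnth pi i < j]) addnC; congr (_ + _).
by apply: eq_card => i; rewrite !inE -leqNgt.
Qed.

Lemma PF_iff_balanced : m <= n -> PF m n pi <-> balanced m (specification pi).
Proof.
move=> mn; rewrite (balancedP _ mn) sum_specification /PF /=.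
split=> [/(@all_parkP _ [::]) park|[_ bal]].
  split=> // j jn; have := park isT j jn; rewrite /= add0n.
  by have := count_geq_specification j; lia.
apply/(@all_parkP _ [::]) => // j jn; rewrite /= add0n.
by have := count_geq_specification j; have := bal j jn; lia.
Qed.

Lemma order_pred_trans i j k : order_pred pi j i -> order_pred pi i k -> order_pred pi j k.
Proof. by rewrite /order_pred /= -!val_eqE /=; lia. Qed.

(** [order_pred] is a total order on the cars whose initial segments are nested by transitivity, so
    the rank is monotone; totality and injectivity of the rank give the converse. *)
Lemma order_permutation_leq i j :
  (order_permutation pi i <= order_permutation pi j) = order_pred pi j i.
Proof.
have mono a b : order_pred pi b a -> order_permutation pi a <= order_permutation pi b.
  move=> ab; rewrite !permE /= -!subn1 leq_sub2r //; apply: subset_leq_card.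
  by apply/fintype.subsetP => k; exact: order_pred_trans.
apply/idP/idP => [le_ij|]; last exact: mono.
apply: contraT => nij; have ji : order_pred pi i j.
  by move: nij; rewrite /order_pred /= -!val_eqE /=; lia.
suff ij : i = j by rewrite ij /order_pred /= eqxx leqnn orbT in nij.
apply: (@perm_inj _ (order_permutation pi)); apply: val_inj.
by apply/eqP; rewrite eqn_leq le_ij mono.
Qed.

(** The cars ranked up to [j] are those with [sigma i <= sigma j], and there are [(sigma j).+1] of
    them. *)
Lemma order_permutation_eq (sigma : {perm 'I_m}) :
  (forall i j, (sigma i <= sigma j) = order_pred pi j i) -> order_permutation pi = sigma.
Proof.
move=> H; apply/permP => j; apply: val_inj; rewrite permE /=.
rewrite -(@eq_card _ [pred i | 0 <= sigma i < (sigma j).+1]).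
  by rewrite card_perm_interval // subn0.
by move=> i; rewrite inE; exact: H.
Qed.

(** The cars ranked up to [i] include [i] and all cars preferring an earlier spot, and none
    preferring a later one. *)
Lemma order_permutation_block i :
  partial_sum (specification pi) (tnth pi i) <= order_permutation pi i <
  partial_sum (specification pi) (tnth pi i).+1.
Proof.
rewrite !partial_sum_specification permE /= -ltnS prednK ?order_card_gt0 //.
apply/andP; split.
  apply: proper_card; apply/fintype.properP; split.
    by apply/fintype.subsetP => j; rewrite !inE => ->.
  by exists i; rewrite !inE ?eqxx ?leqnn ?orbT ?ltnn.
apply: subset_leq_card; apply/fintype.subsetP => j.
by rewrite !inE -val_eqE /=; lia.
Qed.

Lemma order_permutation_compatible :
  compatible (specification pi) (order_permutation pi).
Proof.
apply/(compatibleP _ sum_specification) => k i j ki ij jk.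
have iE : k = tnth pi i.
  apply: (partial_sum_block_inj _ (order_permutation_block i)).
  by rewrite ki (ltn_trans ij jk).
have jE : k = tnth pi j.
  apply: (partial_sum_block_inj _ (order_permutation_block j)).
  by rewrite jk (ltnW (leq_ltn_trans ki ij)).
move: ij; rewrite ltnNge order_permutation_leq /order_pred /= -iE -jE eqxx ltnn /=.
by rewrite -ltnNge.
Qed.

End Tuple.

(** * Recovering the tuple from the pair *)

Lemma specification_order_inj m n (pi pi' : m.-tuple 'I_n) :
  specification pi = specification pi' ->
  order_permutation pi = order_permutation pi' -> pi = pi'.
Proof.
move=> eq_r eq_s; apply: eq_from_tnth => i.
apply: (partial_sum_block_inj (order_permutation_block pi i)).
by rewrite eq_r eq_s; exact: order_permutation_block.
Qed.

Lemma specification_order_surj m n (r : {ffun 'I_n -> nat}) (sigma : {perm 'I_m}) :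
    \sum_(s < n) r s = m -> compatible r sigma ->
  exists2 pi : m.-tuple 'I_n, specification pi = r & order_permutation pi = sigma.
Proof.
move=> tot /(compatibleP _ tot) comp.
have blockb (i : 'I_m) :
    exists k : 'I_n, partial_sum r k <= sigma i < partial_sum r k.+1.
  by apply: partial_sum_block_exists; rewrite partial_sum_total tot.
pose pi := [tuple xchoose (blockb i) | i < m].
have block i : partial_sum r (tnth pi i) <= sigma i < partial_sum r (tnth pi i).+1.
  by rewrite tnth_mktuple; exact: (xchooseP (blockb i)).
exists pi.
  (* As a difference of consecutive partial sums, [r k] counts the values of [sigma] in block [k],
     that is, the cars sent to [k]. *)
  apply/ffunP => k; rewrite ffunE -[r k](addKn (partial_sum r k)) -partial_sumS.
  rewrite -(card_perm_interval sigma (partial_sum r k)); last first.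
    by rewrite -tot -partial_sum_total; apply: leq_partial_sum; exact: ltn_ord.
  apply: eq_card => i; rewrite !inE; apply/eqP/idP => [<- //|].
  exact: partial_sum_block_inj.
apply: order_permutation_eq => i j; rewrite /order_pred /=.
have /andP[li ui] := block i; have /andP[lj uj] := block j.
(* Different blocks are ordered like their spots; within one block compatibility makes [sigma]
   follow the arrival order. *)
rewrite -val_eqE /=; case: (ltngtP (tnth pi i) (tnth pi j)) => [lt|lt|/val_inj eq] /=.
- by have := leq_partial_sum r lt; lia.
- by have := leq_partial_sum r lt; lia.
case: (ltngtP (sigma i) (sigma j)) => [lt|lt|/val_inj/perm_inj -> ].
- by apply/esym/ltnW; apply: comp li lt _; rewrite eq.
- by apply/esym/negbTE; rewrite -ltnNge; apply: comp lj lt _; rewrite -eq.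
- by rewrite leqnn.
Qed.

Theorem theorem2p3 (m n : nat) (hm : 1 <= m) (hmn : m <= n) :
  set_bij (PF m n) (C m n)
    (fun pi : m.-tuple 'I_n => (specification pi, order_permutation pi)).
Proof.
split=> [pi park|pi pi' _ _ [eq_r eq_s]|[r sigma] [/= comp bal]].
- by split; [exact: order_permutation_compatible | exact/PF_iff_balanced].
- exact: specification_order_inj.
have [tot _] := (balancedP r hmn).1 bal.
have [pi rE sE] := specification_order_surj tot comp.
by exists pi; [apply/PF_iff_balanced; rewrite ?rE | rewrite rE sE].
Qed.
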